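(* Let $f(t,x,u)=g(t,x)+h(t,x)u$ with $x\in\mathbb{R}^N$, $u\in\mathbb{R}^M$, let $v$ be a default control with trajectory $x$, let $J(x)=\int_{t_0}^{t_f}l_1(x(t))\,dt+m(x(t_f))$, and let $\frac{dJ}{d\lambda_+}$ and $\frac{d^2J}{d\lambda_+^2}$ be the first- and second-order mode insertion gradients at time $t$ (defined in the context), viewed as functions of the inserted control $u$. For a fixed duration $\lambda$ of inserted control and a metric $R$ on control effort, the minimizer $$u^*(t)=\underset{u}{\operatorname{argmin}}\; J(0)+\lambda\frac{dJ}{d\lambda_+}+\frac{\lambda^2}{2}\frac{d^2J}{d\lambda_+^2}+\frac12\|u\|_R^2$$ is $$u^*(t)=\Big[\frac{\lambda^2}{2}\Gamma+R\Big]^{-1}\Big[\frac{\lambda^2}{2}\Delta+\lambda(-h^T\rho)\Big],$$ where $\Delta\in\mathbb{R}^{M\times 1}$ and $\Gamma\in\mathbb{R}^{M\times M}$ are respectively the first- and second-order derivatives of $\frac{d^2J}{d\lambda_+^2}$ with respect to the control $u$ and are given by $$\Delta=\Big[h^T(\Omega^T+\Omega)h+2h^T\Big(\sum_{k=1}^N(D_xh_k)\rho_k\Big)^T\Big]v+(D_xg\cdot h)^T\rho-\Big(\sum_{k=1}^N(D_xh_k)\rho_k\Big)g+h^TD_xl_1^T,$$ $$\Gamma=\Big[h^T(\Omega^T+\Omega)h+h^T\Big(\sum_{k=1}^N(D_xh_k)\rho_k\Big)^T+\Big(\sum_{k=1}^N(D_xh_k)\rho_k\Big)h\Big]^T.$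$
   Context: All quantities are evaluated at a time $t\in[t_0,t_f]$ along the default trajectory $x$; $J(0)$ is the cost of the default trajectory (no inserted control), and $\|u\|_R^2=u^TRu$. In $\sum_{k=1}^N(D_xh_k)\rho_k$, $h_k$ denotes the $k$-th row of $h\in\mathbb{R}^{N\times M}$ (as a vector in $\mathbb{R}^M$), so $D_xh_k\in\mathbb{R}^{M\times N}$, and $\rho_k$ is the $k$-th component of $\rho$. Write $f_1=f(t,x,v)$ (default dynamics) and $f_2=f(t,x,u)$ (inserted dynamics, applied for a duration $\lambda$). Regularity assumptions: the components of $f_1,f_2$ are real, bounded, $C^2$ in $x$ and $C^0$ in $u,t$; $l_1$ is real, bounded and $C^2$ in $x$; $m$ is real and twice differentiable; $u,v$ are real, bounded and $C^0$ in $t$. Adjoints: $\dot\rho=-D_xl_1^T-D_xf_1^T\rho$, $\rho(t_f)=D_xm(x(t_f))^T$; $\dot\Omega=-D_xf_1^T\Omega-\Omega D_xf_1-D_x^2l_1-\sum_{i=1}^N\rho_iD_x^2f_1^i$, $\Omega(t_f)=D_x^2m(x(t_f))^T$, where $f_1^i$ is the $i$-th component of $f_1$. First-order mode insertion gradient: $\frac{dJ}{d\lambda_+}=\rho^T(f_2-f_1)$. Second-order mode insertion gradient: $$\frac{d^2J}{d\lambda_+^2}=(f_2-f_1)^T\Omega(f_2-f_1)+\rho^T\big(D_xf_2\cdot f_2+D_xf_1\cdot f_1-2D_xf_1\cdot f_2\big)-D_xl_1\cdot(f_2-f_1).$$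
   Formalization: Δ is not literally the derivative of the second-order gradient: the derivative in u is Γu − Δ, and this is what is proved; as a minimizer need not exist, the formula is proved when the argmin is a single point, and the argmin equals it when (λ²/2)Γ + R is positive definite. *)

(* Defs.v *)
From mathcomp Require Import all_boot all_order all_algebra.
From mathcomp Require Import all_classical all_reals all_analysis.

Set Implicit Arguments.
Unset Strict Implicit.
Unset Printing Implicit Defensive.

Import Order.TTheory GRing.Theory Num.Theory.
Import numFieldNormedType.Exports.

Local Open Scope classical_set_scope.
Local Open Scope ring_scope.

(* Vectors are columns.  The Jacobian of F : R^n -> R^p is p x n, that is, the
   transpose of the library's [jacobian], which acts on row vectors; the
   derivative of a scalar function is a row. *)
Definition jac (R : realType) (n p : nat) (F : 'cV[R]_n -> 'cV[R]_p)
    (x : 'cV[R]_n) : 'M[R]_(p, n) :=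
  \matrix_(i, j) ('d F x (delta_mx j 0)) i 0.

Definition deriv_row (R : realType) (n : nat) (phi : 'cV[R]_n -> R)
    (x : 'cV[R]_n) : 'rV[R]_n :=
  \row_j 'd phi x (delta_mx j 0).

Definition hess (R : realType) (n : nat) (phi : 'cV[R]_n -> R) (x : 'cV[R]_n) :
    'M[R]_n :=
  jac (fun y => (deriv_row phi y)^T) x.

Definition twice_differentiable (R : realType) (n : nat)
    (phi : 'cV[R]_n -> R) : Prop :=
  (forall x, differentiable phi x) /\
  (forall x, differentiable (fun y => (deriv_row phi y)^T) x).

Definition C2 (R : realType) (n : nat) (phi : 'cV[R]_n -> R) : Prop :=
  twice_differentiable phi /\ continuous (hess phi).

(* y is continuous on [t0, tf] and y' = F on ]t0, tf[; when F is continuous on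
   [t0, tf] the equation then also holds at t0 and tf, one-sidedly. *)
Definition solves_ode (R : realType) (V : normedModType R) (t0 tf : R)
    (y F : R -> V) : Prop :=
  {within `[t0, tf], continuous y} /\
  (forall t : R, t \in `]t0, tf[ -> is_derive t (1 : R) y (F t)).

Definition positive_definite (R : realType) (n : nat) (A : 'M[R]_n) : Prop :=
  A^T = A /\ (forall u : 'cV[R]_n, u != 0 -> 0 < (u^T *m A *m u) 0 0).

Definition argmin_set (R : realType) (T : Type) (phi : T -> R) : set T :=
  [set u | forall w, phi u <= phi w].

Definition control_affine (R : realType) (N M : nat)
    (g : R -> 'cV[R]_N -> 'cV[R]_N) (h : R -> 'cV[R]_N -> 'M[R]_(N, M))
    (t : R) (y : 'cV[R]_N) (u : 'cV[R]_M) : 'cV[R]_N :=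
  g t y + h t y *m u.

(* Boundedness is asked for each fixed value u of the control: a control-affine
   f is not bounded in u unless h = 0. *)
Definition regular_dynamics (R : realType) (N M : nat) (t0 tf : R)
    (f : R -> 'cV[R]_N -> 'cV[R]_M -> 'cV[R]_N) : Prop :=
  [/\ forall u, [bounded f p.1 p.2 u | p in `[t0, tf] `*` setT],
      forall s u i, s \in `[t0, tf] -> C2 (fun y => f s y u i 0)
    & forall y, {within `[t0, tf] `*` setT,
        continuous (fun p : R * 'cV[R]_M => f p.1 y p.2)} ].

Definition total_cost (R : realType) (N : nat) (t0 tf : R)
    (l1 m : 'cV[R]_N -> R) (x : R -> 'cV[R]_N) : R :=
  (\int[@lebesgue_measure R]_(t in `[t0, tf]) l1 (x t)) + m (x tf).

Definition adjoint1 (R : realType) (N M : nat) (t0 tf : R)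
    (f : R -> 'cV[R]_N -> 'cV[R]_M -> 'cV[R]_N) (l1 m : 'cV[R]_N -> R)
    (v : R -> 'cV[R]_M) (x rho : R -> 'cV[R]_N) : Prop :=
  solves_ode t0 tf rho (fun t =>
    - (deriv_row l1 (x t))^T - (jac (fun y => f t y (v t)) (x t))^T *m rho t)
  /\ rho tf = (deriv_row m (x tf))^T.

Definition adjoint2 (R : realType) (N M : nat) (t0 tf : R)
    (f : R -> 'cV[R]_N -> 'cV[R]_M -> 'cV[R]_N) (l1 m : 'cV[R]_N -> R)
    (v : R -> 'cV[R]_M) (x rho : R -> 'cV[R]_N) (Omega : R -> 'M[R]_N) : Prop :=
  solves_ode t0 tf Omega (fun t =>
    let Df1 := jac (fun y => f t y (v t)) (x t) in
    - (Df1^T *m Omega t) - Omega t *m Df1 - hess l1 (x t)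
    - \sum_i rho t i 0 *: hess (fun y => f t y (v t) i 0) (x t))
  /\ Omega tf = (hess m (x tf))^T.

Section ModeInsertion.
Context (R : realType) (N M : nat).
Variables (f : R -> 'cV[R]_N -> 'cV[R]_M -> 'cV[R]_N) (l1 : 'cV[R]_N -> R).
Variables (v : R -> 'cV[R]_M) (x rho : R -> 'cV[R]_N) (Omega : R -> 'M[R]_N).
Variables (t : R) (u : 'cV[R]_M).

Definition mode_gradient1 : R :=
  ((rho t)^T *m (f t (x t) u - f t (x t) (v t))) 0 0.

Definition mode_gradient2 : R :=
  let f1 := f t (x t) (v t) in
  let f2 := f t (x t) u in
  let Df1 := jac (fun y => f t y (v t)) (x t) in
  let Df2 := jac (fun y => f t y u) (x t) in
  ((f2 - f1)^T *m Omega t *m (f2 - f1)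
   + (rho t)^T *m (Df2 *m f2 + Df1 *m f1 - 2 *: (Df1 *m f2))
   - deriv_row l1 (x t) *m (f2 - f1)) 0 0.

End ModeInsertion.

Definition insertion_objective (R : realType) (N M : nat) (t0 tf : R)
    (f : R -> 'cV[R]_N -> 'cV[R]_M -> 'cV[R]_N) (l1 m : 'cV[R]_N -> R)
    (v : R -> 'cV[R]_M) (x rho : R -> 'cV[R]_N) (Omega : R -> 'M[R]_N)
    (lambda : R) (Rm : 'M[R]_M) (t : R) (u : 'cV[R]_M) : R :=
  total_cost t0 tf l1 m x
  + lambda * mode_gradient1 f v x rho t u
  + lambda ^+ 2 / 2 * mode_gradient2 f l1 v x rho Omega t u
  + 2^-1 * (u^T *m Rm *m u) 0 0.

Section GammaDelta.
Context (R : realType) (N M : nat).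
Variables (g : R -> 'cV[R]_N -> 'cV[R]_N) (h : R -> 'cV[R]_N -> 'M[R]_(N, M)).
Variables (l1 : 'cV[R]_N -> R) (v : R -> 'cV[R]_M) (x rho : R -> 'cV[R]_N).
Variables (Omega : R -> 'M[R]_N) (t : R).

Definition sum_Dh_rho : 'M[R]_(M, N) :=
  \sum_(k < N) rho t k 0 *: jac (fun y => (row k (h t y))^T) (x t).

Definition Delta : 'cV[R]_M :=
  let H := h t (x t) in
  (H^T *m ((Omega t)^T + Omega t) *m H + 2 *: (H^T *m sum_Dh_rho^T)) *m v t
  + (jac (g t) (x t) *m H)^T *m rho t
  - sum_Dh_rho *m g t (x t)
  + H^T *m (deriv_row l1 (x t))^T.

Definition Gamma : 'M[R]_M :=
  let H := h t (x t) in
  (H^T *m ((Omega t)^T + Omega t) *m H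
   + H^T *m sum_Dh_rho^T + sum_Dh_rho *m H)^T.

End GammaDelta.

(* Main.v *)
(* For fixed t both d2J and the objective are quadratic polynomials in u,
   c - b^T u + u^T A u / 2 with A symmetric: the only u-dependent Jacobian enters
   through rho^T (D_x f2) = rho^T (D_x g) + u^T (sum_k (D_x h_k) rho_k).  Such a
   polynomial has gradient A u - b and Hessian A.  A minimizer is a critical
   point, and it is unique only if A is invertible, since translating it along
   ker A does not change the value; if A is positive definite, completing the
   square shows that A^-1 b is the only minimizer. *)

Require Import Defs.
From mathcomp Require Import all_boot all_order all_algebra.
From mathcomp Require Import all_classical all_reals all_analysis.
From mathcomp Require Import ring lra.

Set Implicit Arguments.
Unset Strict Implicit.
Unset Printing Implicit Defensive.

Import Order.TTheory GRing.Theory Num.Theory.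
Import numFieldNormedType.Exports.

Local Open Scope classical_set_scope.
Local Open Scope ring_scope.

(** * Expansion rules for transposes and for scalars seen as 1 x 1 matrices *)

Section MatrixExpansion.
Context {R : realType}.

Lemma trmxD (m n : nat) (A B : 'M[R]_(m, n)) : (A + B)^T = A^T + B^T.
Proof. exact: raddfD. Qed.

Lemma trmxN (m n : nat) (A : 'M[R]_(m, n)) : (- A)^T = - A^T.
Proof. exact: raddfN. Qed.

Lemma trmxZ (m n : nat) (a : R) (A : 'M[R]_(m, n)) : (a *: A)^T = a *: A^T.
Proof. exact: linearZ. Qed.

Lemma mx11D (A B : 'M[R]_1) : (A + B) 0 0 = A 0 0 + B 0 0.
Proof. by rewrite mxE. Qed.

Lemma mx11N (A : 'M[R]_1) : (- A) 0 0 = - A 0 0.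
Proof. by rewrite mxE. Qed.

Lemma mx11Z (a : R) (A : 'M[R]_1) : (a *: A) 0 0 = a * A 0 0.
Proof. by rewrite mxE. Qed.

Lemma tr_mx11 (A : 'M[R]_1) : A^T = A.
Proof. by apply/matrixP => i j; rewrite mxE !ord1. Qed.

Lemma trmx11_inj (A B : 'M[R]_1) : A^T = B -> A = B.
Proof. by rewrite tr_mx11. Qed.

Definition trmxE := (trmxD, trmxN, trmxZ, @trmx_mul, @trmxK).
Definition mx11E := (mx11D, mx11N, mx11Z).

End MatrixExpansion.

(** * Differentiability and Jacobians of matrix-valued functions, computed entrywise *)

Section MatrixDifferentiation.
Context {R : realType}.

Lemma fun_sumE (T : Type) (V : zmodType) (n : nat) (F : 'I_n -> T -> V) :
  (fun z => \sum_i F i z) = \sum_i F i.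
Proof. by apply/funext => z; rewrite fct_sumE. Qed.

(** A matrix is the finite sum of its entries times the constant matrices [delta_mx i j]. *)
Lemma differentiable_mx (V : normedModType R) (m n : nat)
    (F : V -> 'M[R]_(m, n)) (x : V) :
  (forall i j, differentiable (fun z => F z i j) x) -> differentiable F x.
Proof.
move=> dF; have -> : F = \sum_i \sum_j (fun z => F z i j *: delta_mx i j).
  apply/funext => z; rewrite [LHS]matrix_sum_delta fct_sumE.
  by apply: eq_bigr => i _; rewrite fct_sumE.
by do 2!apply: differentiable_sum => ?; apply: differentiableZl.
Qed.

Lemma mulmx_differentiable (m n p : nat) (A : 'M[R]_(m, n))
    (X : 'M[R]_(n, p)) : differentiable (mulmx A) X.
Proof.
apply: differentiable_mx => i j.
under eq_fun do rewrite mxE.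
rewrite fun_sumE; apply: differentiable_sum => k.
exact/differentiableZ/differentiable_coord.
Qed.

(** For s nonzero the difference quotient is p + s k, which tends to p. Affine and quadratic
    functions have this form on every line, so their directional derivatives can be read off from an
    expansion. *)
Lemma derive_slope (V : normedModType R) (F : V -> R) (x d : V) (p k : R) :
  (forall s, F (x + s *: d) = F x + s * p + s ^+ 2 * k) -> 'D_d F x = p.
Proof.
move=> Fxd; apply: cvg_lim => //.
suff : (p + s * k) @[s --> (0 : R)^'] --> p.
  apply: cvg_trans; apply: near_eq_cvg; near=> s.
  have s_neq0 : s != 0 by near: s; exact: nbhs_dnbhs_neq.
  by rewrite /= [_ + x]addrC Fxd /GRing.scale /=; field.
rewrite -[X in _ --> X]addr0 -[X in _ --> _ + X](mul0r k).
apply: cvgD; first exact: cvg_cst.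
by apply: cvgMr_tmp; apply: cvg_within.
Unshelve. all: by end_near. Qed.

Lemma jac_coord (n p : nat) (F : 'cV[R]_n -> 'cV[R]_p) (x : 'cV[R]_n) i j :
  (forall k, differentiable (fun y => F y k 0) x) ->
  jac F x i j = 'D_(delta_mx j 0) (fun y => F y i 0) x.
Proof.
move=> dF; have dFx : differentiable F x.
  by apply: differentiable_mx => k l; rewrite ord1.
rewrite mxE -deriveE// derive_mx ?mxE//.
exact: diff_derivable.
Qed.

Lemma jac_affine (n p : nat) (A : 'M[R]_(p, n)) (b : 'cV[R]_p)
    (x : 'cV[R]_n) :
  differentiable (fun y => A *m y - b) x /\ jac (fun y => A *m y - b) x = A.
Proof.
have dF : differentiable (fun y => A *m y - b) x.
  by apply: differentiableB => //; exact: mulmx_differentiable.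
split=> //; apply/matrixP => i j; rewrite jac_coord; last first.
  by move=> k; exact: (differentiable_comp dF (differentiable_coord _ _ _)).
apply: (derive_slope (k := 0)) => s.
by rewrite mulmxDr -scalemxAr -colE !mxE; ring.
Qed.

End MatrixDifferentiation.

(** * Derivatives and minimizers of quadratic polynomials *)

Section QuadraticFunctions.
Context {R : realType} {n : nat}.
Implicit Types (A : 'M[R]_n) (b u d : 'cV[R]_n) (c : R).

Definition quadratic c A b u : R :=
  c - (b^T *m u) 0 0 + 2^-1 * (u^T *m A *m u) 0 0.

(** This is the exact Taylor expansion at [u]: symmetry merges the two cross terms into one. Both
    the gradient and the minimization results are read off from it. *)
Lemma quadratic_shift c A b u d : A^T = A ->
  quadratic c A b (u + d) =
  quadratic c A b u + ((A *m u - b)^T *m d) 0 0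
  + 2^-1 * (d^T *m A *m d) 0 0.
Proof.
move=> symA; have dAu : d^T *m A *m u = u^T *m A *m d.
  by rewrite -[LHS]tr_mx11 !trmx_mul trmxK symA mulmxA.
rewrite /quadratic !trmxD trmxN trmx_mul symA.
rewrite !(mulmxDl, mulmxDr, mulNmx) dAu !mxE; lra.
Qed.

Lemma quadratic_differentiable c A b u : differentiable (quadratic c A b) u.
Proof.
have diffB0 (B : 'M[R]_(1, n)) : differentiable (fun y => (B *m y) 0 0) u.
  exact: (differentiable_comp (mulmx_differentiable B u)
    (differentiable_coord _ _ _)).
apply: differentiableD; first exact/differentiableB.
apply: differentiableZ.
(* The quadratic form is a sum of products of two linear functions, (A y)_i and y_i. *)
have -> : (fun y : 'cV[R]_n => (y^T *m A *m y) 0 0) =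
    \sum_i (fun y : 'cV[R]_n => (A *m y) i 0) * (fun y => y i 0).
  apply/funext => y; rewrite fct_sumE -mulmxA mxE.
  by apply: eq_bigr => i _; rewrite mxE mulrC.
apply: differentiable_sum => i; apply: differentiableM.
  exact: (differentiable_comp (mulmx_differentiable A u)
    (differentiable_coord _ _ _)).
exact: differentiable_coord.
Qed.

Lemma derive_quadratic c A b u d : A^T = A ->
  'D_d (quadratic c A b) u = ((A *m u - b)^T *m d) 0 0.
Proof.
move=> symA; apply: (derive_slope (k := 2^-1 * (d^T *m A *m d) 0 0)) => s.
by rewrite quadratic_shift// trmxZ -!scalemxAr -!scalemxAl !mxE; ring.
Qed.

Lemma grad_quadratic c A b u : A^T = A ->
  (deriv_row (quadratic c A b) u)^T = A *m u - b.
Proof.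
move=> symA; apply/colP => i; rewrite !mxE -deriveE; last first.
  exact: quadratic_differentiable.
by rewrite derive_quadratic// -colE !mxE.
Qed.

Lemma quadratic_twice_differentiable c A b : A^T = A ->
  twice_differentiable (quadratic c A b).
Proof.
move=> symA; split=> u; first exact: quadratic_differentiable.
under eq_fun do rewrite grad_quadratic//.
exact: (jac_affine _ _ _).1.
Qed.

Lemma hess_quadratic c A b u : A^T = A -> hess (quadratic c A b) u = A.
Proof.
move=> symA; rewrite /hess.
under eq_fun do rewrite grad_quadratic//.
exact: (jac_affine _ _ _).2.
Qed.

(** If p were nonzero, the linear term would dominate for small s of the opposite sign and make the
    sum negative. *)
Lemma linear_term_eq0 (p k : R) : (forall s, 0 <= s * p + s ^+ 2 * k) -> p = 0.
Proof.
move=> ge0; have [//|p_neq0] := eqVneq p 0.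
have k1_gt0 : 0 < `|k| + 1 by rewrite ltr_wpDl.
(* At this s the sum is (p / (|k| + 1))^2 (k - |k| - 1), negative since k <= |k|. The added 1 keeps
   the denominator nonzero and the inequality strict. *)
have := ge0 (- p / (`|k| + 1)); rewrite leNgt => /negP[].
have -> : - p / (`|k| + 1) * p + (- p / (`|k| + 1)) ^+ 2 * k =
    (p / (`|k| + 1)) ^+ 2 * (k - `|k| - 1) by field; rewrite gt_eqF.
rewrite pmulr_rlt0; first by move: (ler_norm k); lra.
by rewrite exprn_even_gt0//= mulf_neq0// invr_eq0 gt_eqF.
Qed.

(** Moving from [u] by s along the i-th basis vector changes the value by s (A u - b)_i plus a
    multiple of s^2; minimality forces the linear coefficient to vanish. *)
Lemma quadratic_argmin_critical c A b u : A^T = A ->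
  argmin_set (quadratic c A b) u -> A *m u = b.
Proof.
move=> symA umin; apply/eqP; rewrite -subr_eq0; apply/eqP/colP => i.
pose e : 'cV[R]_n := delta_mx i 0.
have -> : (A *m u - b) i 0 = ((A *m u - b)^T *m e) 0 0.
  by rewrite /e -colE [RHS]mxE [RHS]mxE.
rewrite [RHS]mxE.
apply: (linear_term_eq0 (k := 2^-1 * (e^T *m A *m e) 0 0)) => s.
have := umin (u + s *: e); rewrite quadratic_shift// -subr_ge0.
rewrite trmxZ -!scalemxAr -!scalemxAl !mx11E => /le_trans; apply.
by rewrite le_eqVlt; apply/orP; left; apply/eqP; ring.
Qed.

(** A zero determinant gives a row vector in the left kernel; by symmetry its transpose lies in the
    right kernel. *)
Lemma sym_singular_kernel A : A^T = A -> A \notin unitmx ->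
  exists2 d : 'cV[R]_n, d != 0 & A *m d = 0.
Proof.
move=> symA; rewrite unitmxE unitfE negbK => /det0P[r r_neq0 rA].
exists r^T; first by rewrite -trmx0 (inj_eq trmx_inj).
by rewrite -{1}symA -trmx_mul rA trmx0.
Qed.

Lemma quadratic_argmin_unique c A b u : A^T = A ->
  argmin_set (quadratic c A b) = [set u] ->
  A \in unitmx /\ u = invmx A *m b.
Proof.
move=> symA argminE.
have umin : argmin_set (quadratic c A b) u by rewrite argminE.
have Au := quadratic_argmin_critical symA umin.
have A_unit : A \in unitmx.
  apply/negPn/negP => /(sym_singular_kernel symA)[d /eqP + Ad]; apply.
  (* Since A u = b and A d = 0, both correction terms of the expansion at [u] vanish, so u + d is a
     second minimizer. *)
  have : argmin_set (quadratic c A b) (u + d).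
    move=> w; rewrite quadratic_shift// Au subrr trmx0 mul0mx.
    by rewrite -mulmxA Ad mulmx0 !mxE mulr0 !addr0; apply: umin.
  by rewrite argminE => /= /eqP; rewrite -subr_eq0 addrAC subrr add0r => /eqP.
by split=> //; rewrite -Au mulKmx.
Qed.

Lemma posdef_unitmx A : positive_definite A -> A \in unitmx.
Proof.
move=> [symA Apos]; apply/negPn/negP => /(sym_singular_kernel symA)[d d_neq0 Ad].
by have := Apos d d_neq0; rewrite -mulmxA Ad mulmx0 mxE ltxx.
Qed.

Lemma quadratic_argmin_posdef c A b : positive_definite A ->
  argmin_set (quadratic c A b) = [set invmx A *m b].
Proof.
move=> Apd; have [symA Apos] := Apd; have A_unit := posdef_unitmx Apd.
apply/seteqP; split => [u umin /=|_ -> w].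
  by rewrite -(quadratic_argmin_critical symA umin) mulKmx.
(* Expanding at A^-1 b leaves only the quadratic form in w - A^-1 b. The zero vector is treated
   apart, as positivity is given for nonzero vectors. *)
rewrite -[w](subrKC (invmx A *m b)) quadratic_shift// mulKVmx// subrr.
rewrite trmx0 mul0mx mxE addr0 lerDl mulr_ge0 ?invr_ge0//.
have [->|/Apos/ltW//] := eqVneq (w - invmx A *m b) 0.
by rewrite mulmx0 mxE.
Qed.

End QuadraticFunctions.

(** * The insertion gradients and the objective as quadratics in the control *)

Section ControlAffine.
Context {R : realType} {N M : nat}.
Context (g : R -> 'cV[R]_N -> 'cV[R]_N) (h : R -> 'cV[R]_N -> 'M[R]_(N, M)).
Context (x rho : R -> 'cV[R]_N) (t : R).
Context (g_diff : forall i, differentiable (fun y => g t y i 0) (x t)).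
Context (h_diff : forall i j, differentiable (fun y => h t y i j) (x t)).

Lemma jac_control_affine u :
  (rho t)^T *m jac (fun y => control_affine g h t y u) (x t) =
  (rho t)^T *m jac (g t) (x t) + u^T *m sum_Dh_rho h x rho t.
Proof.
have hu_diff i : differentiable (fun y => (h t y *m u) i 0) (x t).
  under eq_fun do rewrite mxE.
  rewrite fun_sumE; apply: differentiable_sum => k.
  by under eq_fun do rewrite mulrC; apply: differentiableZ.
have f_diff i : differentiable (fun y => control_affine g h t y u i 0) (x t).
  under eq_fun do rewrite mxE.
  exact: differentiableD.
apply/rowP => j; rewrite !mxE.
(* Exchanging the sums over controls and states turns the entries of u^T [sum_Dh_rho] into
   derivatives of the components of h u, weighted by [rho]. *)
have -> : \sum_i (u^T) 0 i * (sum_Dh_rho h x rho t) i j =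
    \sum_k rho t k 0 * 'D_(delta_mx j 0) (fun y => (h t y *m u) k 0) (x t).
  rewrite /sum_Dh_rho.
  under eq_bigr do rewrite summxE mulr_sumr.
  rewrite exchange_big; apply: eq_bigr => k _ /=.
  under [in RHS]eq_fun do rewrite mxE.
  rewrite fun_sumE derive_sum; last first.
    move=> c; apply: diff_derivable.
    by under eq_fun do rewrite mulrC; apply: differentiableZ.
  rewrite mulr_sumr; apply: eq_bigr => c _.
  rewrite [X in _ * X]mxE jac_coord; last first.
    by move=> c'; under eq_fun do rewrite !mxE; exact: h_diff.
  under eq_fun do rewrite !mxE.
  rewrite (_ : (fun y => _ * _) = u c 0 *: (fun y => h t y k c)); last first.
    by apply/funext => y; rewrite mulrC.
  rewrite deriveZ; last exact: diff_derivable.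
  by rewrite mxE mulrCA.
rewrite -big_split; apply: eq_bigr => k _ /=; rewrite mxE -mulrDr; congr (_ * _).
have f_split : (fun y => control_affine g h t y u k 0) =
    (fun y => g t y k 0) + (fun y => (h t y *m u) k 0).
  by apply/funext => y; rewrite mxE.
rewrite [LHS](jac_coord k j f_diff) [jac (g t) _ _ _](jac_coord k j g_diff).
rewrite -(deriveD (diff_derivable (g_diff k)) (diff_derivable (hu_diff k))).
by rewrite f_split.
Qed.

Lemma control_affineB (s : R) (y : 'cV[R]_N) (u w : 'cV[R]_M) :
  control_affine g h s y u - control_affine g h s y w = h s y *m (u - w).
Proof. by rewrite /control_affine opprD addrACA subrr add0r mulmxBr. Qed.

(** Transposition swaps the two summands of Omega^T + Omega, and likewise the two terms containing
    [sum_Dh_rho]. *)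
Lemma Gamma_sym (Omega : R -> 'M[R]_N) :
  (Gamma h x rho Omega t)^T = Gamma h x rho Omega t.
Proof.
rewrite /Gamma trmxK !trmxD !trmx_mul !trmxD !trmxK !mulmxA (addrC (Omega t)).
by rewrite addrAC.
Qed.

Lemma mode_gradient2_quadratic (l1 : 'cV[R]_N -> R) (v : R -> 'cV[R]_M)
    (Omega : R -> 'M[R]_N) (u : 'cV[R]_M) :
  let d2J := mode_gradient2 (control_affine g h) l1 v x rho Omega t in
  d2J u = quadratic (d2J 0) (Gamma h x rho Omega t)
            (Delta g h l1 v x rho Omega t) u.
Proof.
rewrite /= -[in RHS](Gamma_sym Omega) /Gamma trmxK /Delta.
rewrite /mode_gradient2 !control_affineB /quadratic.
(* Jacobians occur at the controls [u], [v t] and, through the constant term [d2J 0], at 0. Once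
   their products with rho^T are replaced, the claim is pure matrix algebra. *)
have := jac_control_affine u; have := jac_control_affine (v t).
have := jac_control_affine 0.
rewrite /control_affine trmx0 mul0mx addr0.
move: (sum_Dh_rho h x rho t) (h t (x t)) (g t (x t)) (Omega t) (v t) => S H G O w.
move: (deriv_row l1 (x t)) (rho t) (jac (g t) (x t)) => l r J.
move: (jac _ _) (jac _ _) (jac _ _) => J0 J1 J2 rJ0 rJ1 rJ2.
rewrite mulmx0 addr0 sub0r !mulmxDr !mulmxN -!scalemxAr !mulmxA rJ0 rJ1 rJ2.
rewrite !trmxE.
rewrite !(mulmxDl, mulmxDr, mulmxN, mulNmx, mulmxA, trmxD, trmxN).
rewrite -!(scalemxAl, scalemxAr) !mulmxA rJ1 !mulmxDl.
(* A 1 x 1 product equals its transpose. The next rewrites use this to give monomials that differ by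
   reversal one common form, so that linear arithmetic can match them. *)
have -> : u^T *m H^T *m O^T *m H *m u = u^T *m H^T *m O *m H *m u.
  by apply: trmx11_inj; rewrite !trmx_mul !trmxK !mulmxA.
have -> : w^T *m H^T *m O^T *m H *m u = u^T *m H^T *m O *m H *m w.
  by apply: trmx11_inj; rewrite !trmx_mul !trmxK !mulmxA.
have -> : G^T *m S^T *m u = u^T *m S *m G.
  by apply: trmx11_inj; rewrite !trmx_mul !trmxK !mulmxA.
have -> : u^T *m H^T *m S^T *m u = u^T *m S *m H *m u.
  by apply: trmx11_inj; rewrite !trmx_mul !trmxK !mulmxA.
by rewrite !mx11E; lra.
Qed.

(** Since f2 - f1 = h (u - v), the first-order gradient is affine in [u] with slope rho^T h, which
    gives the term -h^T rho of the linear coefficient; the control effort adds [Rm] to the quadratic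
    one. *)
Lemma insertion_objective_quadratic (t0 tf : R) (l1 m : 'cV[R]_N -> R)
    (v : R -> 'cV[R]_M) (Omega : R -> 'M[R]_N) (lambda : R) (Rm : 'M[R]_M)
    (u : 'cV[R]_M) :
  let objective := insertion_objective t0 tf (control_affine g h) l1 m v x rho
    Omega lambda Rm t in
  objective u = quadratic (objective 0)
    ((lambda ^+ 2 / 2) *: Gamma h x rho Omega t + Rm)
    ((lambda ^+ 2 / 2) *: Delta g h l1 v x rho Omega t
     + lambda *: - ((h t (x t))^T *m rho t)) u.
Proof.
rewrite /= /insertion_objective (mode_gradient2_quadratic _ _ _ u) /=.
move: (mode_gradient2 _ _ _ _ _ _ _ 0) (total_cost _ _ _ _ _) => c2 c0.
rewrite /mode_gradient1 !control_affineB /quadratic.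
move: (Gamma _ _ _ _ _) (Delta _ _ _ _ _ _ _ _) (h t (x t)) (rho t) (v t).
move=> G D H r w.
have zero00 : (0 : 'M[R]_1) 0 0 = 0 by rewrite mxE.
rewrite mulmx0 zero00 sub0r !trmxE.
rewrite !(mulmxDl, mulmxDr, mulmxN, mulNmx, mulmxA).
rewrite -!(scalemxAl, scalemxAr) mulNmx !mx11E; lra.
Qed.

End ControlAffine.

Theorem mainTheorem3 (R : realType) (N M : nat) (t0 tf : R)
    (g : R -> 'cV[R]_N -> 'cV[R]_N) (h : R -> 'cV[R]_N -> 'M[R]_(N, M))
    (l1 m : 'cV[R]_N -> R) (v : R -> 'cV[R]_M) (x rho : R -> 'cV[R]_N)
    (Omega : R -> 'M[R]_N) (lambda : R) (Rm : 'M[R]_M)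
    (f := control_affine g h)
    (t0_lt_tf : t0 < tf)
    (f_reg : regular_dynamics t0 tf f)
    (l1_bounded : [bounded l1 y | y in setT])
    (l1_C2 : C2 l1)
    (m_diff2 : twice_differentiable m)
    (v_bounded : [bounded v s | s in `[t0, tf]])
    (v_cont : {within `[t0, tf], continuous v})
    (x_traj : solves_ode t0 tf x (fun s => f s (x s) (v s)))
    (rho_adj : adjoint1 t0 tf f l1 m v x rho)
    (Omega_adj : adjoint2 t0 tf f l1 m v x rho Omega)
    (lambda_ge0 : 0 <= lambda)
    (Rm_metric : positive_definite Rm) :
  forall t : R, t \in `[t0, tf] ->
  let d2J := mode_gradient2 f l1 v x rho Omega t in
  let objective :=
    insertion_objective t0 tf f l1 m v x rho Omega lambda Rm t in
  let D := Delta g h l1 v x rho Omega t in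
  let G := Gamma h x rho Omega t in
  let A := (lambda ^+ 2 / 2) *: G + Rm in
  let b := (lambda ^+ 2 / 2) *: D + lambda *: - ((h t (x t))^T *m rho t) in
  [/\ twice_differentiable d2J,
      forall u, (deriv_row d2J u)^T = G *m u - D,
      forall u, hess d2J u = G,
      forall ustar, argmin_set objective = [set ustar] ->
        A \in unitmx /\ ustar = invmx A *m b
    & positive_definite A -> argmin_set objective = [set invmx A *m b] ].
Proof.
move=> t t_in d2J objective D G A b.
have [_ f_C2 _] := f_reg.
have f_diff u i : differentiable (fun y => f t y u i 0) (x t).
  by have [[+ _] _] := f_C2 t u i t_in; apply.
(* Regularity is assumed for [f] and is passed on: [g] is [f] at control 0, and column j of [h] is
   [f] at the j-th basis control minus [g]. *)
have g_diff i : differentiable (fun y => g t y i 0) (x t).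
  have -> : (fun y => g t y i 0) = (fun y => f t y 0 i 0).
    by apply/funext => y; rewrite /f /control_affine mulmx0 addr0.
  exact: f_diff.
have h_diff i j : differentiable (fun y => h t y i j) (x t).
  have -> : (fun y => h t y i j) =
      (fun y => f t y (delta_mx j 0) i 0) \- (fun y => g t y i 0).
    apply/funext => y.
    by rewrite /f /control_affine /= -colE !mxE addrAC subrr add0r.
  exact: differentiableB.
have symG : G^T = G by exact: Gamma_sym.
have symA : A^T = A by rewrite trmxD trmxZ symG Rm_metric.1.
have d2JE : d2J = quadratic (d2J 0) G D.
  by apply/funext => u; exact: mode_gradient2_quadratic.
have objE : objective = quadratic (objective 0) A b.
  by apply/funext => u; exact: insertion_objective_quadratic.
rewrite d2JE objE; split.
- exact: quadratic_twice_differentiable.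
- by move=> u; exact: grad_quadratic.
- by move=> u; exact: hess_quadratic.
- by move=> ustar; exact: quadratic_argmin_unique.
- exact: quadratic_argmin_posdef.
Qed.
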